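(* For each $\rho\in(0,1)$ and all $m\in\mathbb{N}$, $$E(X_\rho^m)=B_m\bigl(\kappa_\rho^{(1)},\kappa_\rho^{(2)},\dots,\kappa_\rho^{(m)}\bigr),$$ where $\kappa_\rho^{(j)}=\sum_{k=1}^\infty \frac{k^{j-1}\rho^k}{1-\rho^k}$ for $j\in\mathbb{N}$, and $B_m$ is the $m$-th complete Bell polynomial.
   Context: $\mathbb{N}=\{1,2,3,\dots\}$. Frog model (single-frog case). Fix $\rho\in(0,1)$ and let $p=\frac{1}{1+\rho}\in(\tfrac12,1)$, so that $\rho=\frac{1-p}{p}$. At each site $x\in\mathbb{Z}$ with $x\ge 0$ there is initially exactly one particle (''frog''), and there are no frogs at sites $x<0$. At time $0$ the frog at the origin is active and all others are sleeping. Active frogs perform, in discrete time, simultaneously and independently of each other, nearest-neighbour random walks on $\mathbb{Z}$, each step being $+1$ with probability $p$ and $-1$ with probability $1-p$. When an active frog visits a site containing a sleeping frog, that frog becomes active and from then on performs the same kind of random walk starting from its initial location; all random walk transitions are independent. $X_\rho$ denotes a random variable with the distribution of the negative of the minimum of the set of sites visited by active frogs (this minimum is almost surely finite, and $X_\rho\ge 0$). Bell polynomials. For $1\le k\le m$, $$B_{m,k}(x_1,\dots,x_{m-k+1})=\sum\frac{m!}{k_1!\,k_2!\cdots k_{m-k+1}!}\Bigl(\frac{x_1}{1!}\Bigr)^{k_1}\Bigl(\frac{x_2}{2!}\Bigr)^{k_2}\cdots\Bigl(\frac{x_{m-k+1}}{(m-k+1)!}\Bigr)^{k_{m-k+1}},$$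 the sum being over all sequences of nonnegative integers $k_1,\dots,k_{m-k+1}$ with $k_1+\cdots+k_{m-k+1}=k$ and $k_1+2k_2+\cdots+(m-k+1)k_{m-k+1}=m$. The $m$-th complete Bell polynomial is $B_m(x_1,\dots,x_m)=\sum_{k=1}^m B_{m,k}(x_1,\dots,x_{m-k+1})$. *)

(* Defs.v *)
From HB Require Import structures.
From mathcomp Require Import all_boot all_order all_algebra finmap.
From mathcomp Require Import all_classical all_reals all_analysis.
Set Implicit Arguments.
Unset Strict Implicit.
Unset Printing Implicit Defensive.
Import Order.TTheory GRing.Theory Num.Theory.
Import numFieldNormedType.Exports.
Local Open Scope classical_set_scope.
Local Open Scope ring_scope.

(** Deterministic dynamics. [c x i] says whether the [i]-th step made by the
    frog starting at [x] (counted from its own activation) is [+1] ([true]) or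
    [-1] ([false]). *)

Definition step_of (b : bool) : int := if b then 1 else -1.

Definition walk (c : nat -> nat -> bool) (x n : nat) : int :=
  x%:Z + \sum_(i < n) step_of (c x i).

(** [age c t x] is [None] if the frog of site [x] is still asleep at time [t],
    and [Some n] if it is active and has made [n] steps by then; in the latter
    case its position at time [t] is [walk c x n]. *)
Fixpoint age (c : nat -> nat -> bool) (t x : nat) : option nat :=
  match t with
  | 0%N => if x == 0%N then Some 0%N else None
  | t'.+1 =>
      match age c t' x with
      | Some n => Some n.+1
      | None =>
          if `[< exists y n : nat,
                   age c t' y = Some n /\ walk c y n.+1 = x%:Z >]
          then Some 0%N else None
      end
  end.

Definition visited (c : nat -> nat -> bool) : set int :=
  [set z | exists t x n : nat, age c t x = Some n /\ walk c x n = z].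

(** Negative of the minimum of the visited sites. It takes the value [+oo] on
    the (null) event that there is no minimum. *)
Definition neg_min {R : realType} (c : nat -> nat -> bool) : \bar R :=
  (- ereal_inf [set (z%:~R)%:E | z in visited c])%E.

Definition mutually_independent {R : realType} {d d' : measure_display}
    {T : measurableType d} {T' : measurableType d'} (P : probability T R)
    (I : choiceType) (X : I -> T -> T') : Prop :=
  forall (J : {fset I}) (A : I -> set T'),
    (forall i, measurable (A i)) ->
    P (\bigcap_(i in [set` J]) (X i @^-1` A i)) =
    \big[*%E/1%E]_(i <- J) P (X i @^-1` A i).

(** [xi (x, i)] is the random direction of the [i]-th step of the frog starting
    at [x]. *)
Definition frog_steps {R : realType} {d : measure_display}
    {T : measurableType d} (P : probability T R) (p : R)
    (xi : nat * nat -> {RV P >-> bool}) : Prop :=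
  (forall a, P [set w | step_of (xi a w) = 1] = p%:E) /\
  (forall a, P [set w | step_of (xi a w) = -1] = (1 - p)%:E) /\
  mutually_independent P (fun a => xi a : T -> bool).

Definition frog_X {R : realType} {d : measure_display} {T : measurableType d}
    {P : probability T R} (xi : nat * nat -> {RV P >-> bool}) (w : T) : \bar R :=
  neg_min (fun x i => xi (x, i) w).

(** Partial Bell polynomial. Only [x 1], ..., [x (m - k + 1)] are used. The
    multiplicity [k_(i+1)] is [e i]; the bound [e i <= k] loses nothing since
    the multiplicities sum to [k]. *)
Definition partial_bell {R : realType} (m k : nat) (x : nat -> R) : R :=
  \sum_(e : {ffun 'I_(m - k).+1 -> 'I_k.+1} |
        (\sum_(i < (m - k).+1) e i == k)%N &&
        (\sum_(i < (m - k).+1) i.+1 * e i == m)%N)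
    (m`!)%:R / (\prod_(i < (m - k).+1) ((e i)`!)%:R) *
    \prod_(i < (m - k).+1) (x i.+1 / (i.+1`!)%:R) ^+ e i.

Definition complete_bell {R : realType} (m : nat) (x : nat -> R) : R :=
  \sum_(1 <= k < m.+1) partial_bell m k x.

Definition kappa {R : realType} (rho : R) (j : nat) : R :=
  \big[+%R/0]_(1 <= k <oo) (k%:R ^+ j.-1 * rho ^+ k / (1 - rho ^+ k)).

(* Main.v *)
Require Import Defs.
From HB Require Import structures.
From mathcomp Require Import all_boot all_order all_algebra finmap.
From mathcomp Require Import all_classical all_reals all_analysis.
From mathcomp Require Import measurable_realfun zify ring lra.
Set Implicit Arguments.
Unset Strict Implicit.
Unset Printing Implicit Defensive.
Import Order.TTheory GRing.Theory Num.Theory.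
Import numFieldNormedType.Exports.
Local Open Scope classical_set_scope.
Local Open Scope ring_scope.

(* Almost surely the frog of the origin visits every positive site, so all frogs
   wake up and X = max_x (M_x - x), where M_x is minus the minimum of the walk of
   the frog x relative to its start. The M_x are independent with
   P(M_x < h) = 1 - rho^h, hence P(X <= k) = Q_k := prod_{j > k} (1 - rho^j) and
   P(X = k) = a_k := rho^k Q_k. The generating function of a is
   A(z) = prod_{j >= 1} (1 - rho^j) / (1 - z rho^j), and z A'(z) / A(z) has
   coefficients rho^n / (1 - rho^n). Read on coefficients, this gives
   E X^(m+1) = sum_i C(m, i) kappa_(i+1) E X^(m-i), which is also the recurrence
   of the complete Bell polynomials. *)

(** The main obstacle is independence: [mutually_independent] speaks of finitely many single steps,
    while the events of interest involve infinitely many steps of infinitely many frogs. So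
    probabilities are first computed for [N] steps of the first [M] frogs, revealing one step at a
    time. Then [N] tends to infinity with [M] fixed, where the product over frogs is finite, and
    only afterwards does [M]. The value 1 - rho^h is a gambler's ruin computation: the limiting
    survival probability is harmonic in the starting height, which determines it up to a constant,
    and boundedness fixes the constant. Exchanging p and 1 - p in the same computation shows that
    the origin's frog hits every positive site. Moments are series of nonnegative terms in the
    extended reals, so sums may be exchanged freely and finiteness of each moment falls out of the
    recurrence. *)

(** * Recurrence of the complete Bell polynomials *)

Definition exp_weight {R : fieldType} (y : nat -> R) n K
    (e : {ffun 'I_n -> 'I_K}) : R :=
  \prod_(i < n) (y i ^+ e i / (e i)`!%:R).

Definition part_size n K (e : {ffun 'I_n -> 'I_K}) : nat :=
  (\sum_(i < n) i.+1 * e i)%N.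

(** For [m <= N] this is the coefficient of t^m in the exponential of the sum of [y i] t^(i+1) over
    i < N; the bound on multiplicities is harmless there, as none can exceed [m]. Fixing [N] keeps
    one index type for all [m]. *)
Definition bell_sum {R : fieldType} (y : nat -> R) N m : R :=
  \sum_(e : {ffun 'I_N -> 'I_N.+1} | part_size e == m) exp_weight y e.

Lemma part_size_ge n K (e : {ffun 'I_n -> 'I_K}) (i : 'I_n) :
  (i.+1 * e i <= part_size e)%N.
Proof. by rewrite /part_size (bigD1 i) //= leq_addr. Qed.

Lemma sum_leq_part_size n K (e : {ffun 'I_n -> 'I_K}) :
  (\sum_(i < n) e i <= part_size e)%N.
Proof. by apply: leq_sum => i _; rewrite leq_pmull. Qed.

Lemma part_size_eq0 n K (e : {ffun 'I_n -> 'I_K.+1}) :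
  (part_size e == 0%N) = (e == [ffun=> ord0]).
Proof.
apply/eqP/eqP => [e0|->]; last first.
  by rewrite /part_size big1 // => i _; rewrite ffunE muln0.
apply/ffunP => i; rewrite ffunE; apply/val_inj => /=.
by have := part_size_ge e i; rewrite e0; case: (nat_of_ord (e i)).
Qed.

Lemma bell_sum0 (R : fieldType) (y : nat -> R) N : bell_sum y N 0 = 1.
Proof.
rewrite /bell_sum (big_pred1 [ffun=> ord0]); last first.
  by move=> e; rewrite part_size_eq0.
by rewrite /exp_weight big1 // => i _; rewrite ffunE expr0 fact0 invr1 mulr1.
Qed.

Section Incr.
Variables (N : nat) (i : 'I_N).
Implicit Type e : {ffun 'I_N -> 'I_N.+1}.

Definition incr_part e : {ffun 'I_N -> 'I_N.+1} :=
  [ffun j => if j == i then inord (e j).+1 else e j].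
Definition decr_part e : {ffun 'I_N -> 'I_N.+1} :=
  [ffun j => if j == i then inord (e j).-1 else e j].

Lemma decr_partE e : (decr_part e i : nat) = (e i).-1.
Proof. by rewrite ffunE eqxx inordK // (leq_ltn_trans (leq_pred _)). Qed.

Lemma incr_partE e : (e i < N)%N -> (incr_part e i : nat) = (e i).+1.
Proof. by move=> eiN; rewrite ffunE eqxx inordK. Qed.

Lemma incr_part_neq e j : j != i -> incr_part e j = e j.
Proof. by move=> /negPf ji; rewrite ffunE ji. Qed.

Lemma decr_part_neq e j : j != i -> decr_part e j = e j.
Proof. by move=> /negPf ji; rewrite ffunE ji. Qed.

Lemma decr_partK e : (0 < e i)%N -> incr_part (decr_part e) = e.
Proof.
move=> e0; apply/ffunP => j; have [->|ji] := eqVneq j i.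
  have lt : (decr_part e i < N)%N.
    by rewrite decr_partE; have := ltn_ord (e i); lia.
  by apply/val_inj; rewrite /= (incr_partE lt) decr_partE prednK.
by rewrite incr_part_neq // decr_part_neq.
Qed.

Lemma incr_partK e : (e i < N)%N -> decr_part (incr_part e) = e.
Proof.
move=> e0; apply/ffunP => j; have [->|ji] := eqVneq j i.
  by apply/val_inj; rewrite /= decr_partE incr_partE.
by rewrite decr_part_neq // incr_part_neq.
Qed.

Lemma part_size_incr e : (e i < N)%N ->
  part_size (incr_part e) = (part_size e + i.+1)%N.
Proof.
move=> eiN; rewrite /part_size (bigD1 i) //= [in RHS](bigD1 i) //= incr_partE //.
under eq_bigr => j ji do rewrite incr_part_neq //.
by rewrite mulnS -addnA addnC.
Qed.

Lemma exp_weight_incr (R : numFieldType) (y : nat -> R) e : (e i < N)%N ->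
  (e i).+1%:R * exp_weight y (incr_part e) = y i * exp_weight y e.
Proof.
move=> eiN; rewrite /exp_weight (bigD1 i) //= [in RHS](bigD1 i) //= incr_partE //.
under eq_bigr => j ji do rewrite incr_part_neq //.
rewrite factS natrM exprS invfM.
have : (e i).+1%:R != 0 :> R by rewrite pnatr_eq0.
by move: (_%:R) => a a0; rewrite !mulrA; congr (_ * _ * _);
  rewrite mulrC !mulrA mulVf // mul1r.
Qed.

End Incr.

(** Removing one part of size [i.+1] is a bijection from the [e] with [e i > 0], and the factor
    [e i] cancels against its factorial, leaving [y i] times the weight of the smaller [e]. *)
Lemma sum_mul_exp_weight (R : numFieldType) (y : nat -> R) N m (i : 'I_N) :
  (m < N)%N ->
  \sum_(e : {ffun 'I_N -> 'I_N.+1} | part_size e == m.+1)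
     (e i)%:R * exp_weight y e =
  if (i <= m)%N then y i * bell_sum y N (m - i)%N else 0.
Proof.
move=> mN; rewrite (bigID (fun e : {ffun 'I_N -> 'I_N.+1} => (0 < e i)%N)) /=.
rewrite [X in _ + X]big1 ?addr0; last first.
  by move=> e /andP[_]; rewrite -eqn0Ngt => /eqP ->; rewrite mul0r.
rewrite (reindex_onto (@incr_part N i) (@decr_part N i)); last first.
  by move=> e /andP[_ /decr_partK].
have cond (e : {ffun 'I_N -> 'I_N.+1}) :
   (part_size (incr_part i e) == m.+1) && (0 < incr_part i e i)%N &&
   (decr_part i (incr_part i e) == e) = (part_size e + i == m)%N.
  have [eiN|eiN] := ltnP (e i) N.
    by rewrite part_size_incr // incr_partE // incr_partK // eqxx !andbT addnS.
  (* If [e i] is already [N], incrementing leaves the range. Both sides are then false: the size of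
     [e] exceeds [m], and a decremented entry is at most [N - 1]. *)
  have -> : (part_size e + i == m)%N = false.
    apply/negbTE; rewrite neq_ltn; apply/orP; right.
    have := part_size_ge e i; have : (e i <= i.+1 * e i)%N by rewrite leq_pmull.
    lia.
  apply/negbTE/negP => /andP[_ /eqP /ffunP /(_ i) /(congr1 val)] /=.
  rewrite decr_partE => ei.
  have : ((e i).-1 < N)%N by have := ltn_ord (e i); have := ltn_ord i; lia.
  have := ltn_ord (incr_part i e i); have := ltn_ord i; lia.
under eq_bigl => e do rewrite cond.
have [im|im] := leqP i m; last first.
  by rewrite big_pred0 // => e; apply/negbTE; lia.
rewrite /bell_sum big_distrr /=; apply: eq_big => [e|e /eqP eim]; first by lia.
have eiN : (e i < N)%N.
  have := part_size_ge e i; have : (e i <= i.+1 * e i)%N by rewrite leq_pmull.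
  lia.
by rewrite -exp_weight_incr // incr_partE.
Qed.

(** This is F' = G' F for F = exp G, on coefficients: the factor [m.+1] is written as the size of
    [e], hence as a sum over [i], and the sums are exchanged. *)
Lemma bell_sumS (R : numFieldType) (y : nat -> R) N m : (m < N)%N ->
  m.+1%:R * bell_sum y N m.+1 =
  \sum_(i < m.+1) i.+1%:R * y i * bell_sum y N (m - i)%N.
Proof.
move=> mN; rewrite {1}/bell_sum big_distrr /=.
under eq_bigr => e /eqP <-.
  rewrite {1}/part_size natr_sum big_distrl /=.
  under eq_bigr => i _ do rewrite natrM -mulrA.
  over.
rewrite exchange_big /=.
under eq_bigr => i _ do rewrite -big_distrr /= sum_mul_exp_weight //.
rewrite (big_ord_widen N (fun i => i.+1%:R * y i * bell_sum y N (m - i)%N)) //.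
rewrite [RHS]big_mkcond /=; apply: eq_bigr => i _; rewrite ltnS.
by case: ifP => _; rewrite ?mulr0 // mulrA.
Qed.

Section Widen.
Variables (n K N : nat).
Hypotheses (nN : (n < N)%N) (KN : (K <= N)%N).

(** Padding by zero multiplicities brings the index types of [partial_bell], which vary with [m] and
    [k], into the single one of [bell_sum]. *)
Definition widen_part (e : {ffun 'I_n.+1 -> 'I_K.+1}) : {ffun 'I_N -> 'I_N.+1} :=
  [ffun i : 'I_N => if (i <= n)%N then inord (e (inord i)) else ord0].
Definition narrow_part (e : {ffun 'I_N -> 'I_N.+1}) : {ffun 'I_n.+1 -> 'I_K.+1} :=
  [ffun i : 'I_n.+1 => inord (e (widen_ord nN i))].

Lemma widen_partE e (i : 'I_N) :
  (widen_part e i : nat) = if (i <= n)%N then e (inord i) : nat else 0%N.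
Proof.
rewrite ffunE; case: ifP => // _.
by rewrite inordK // ltnS (leq_trans _ KN) // -ltnS.
Qed.

Lemma widen_partK : cancel widen_part narrow_part.
Proof.
move=> e; apply/ffunP => i; rewrite ffunE; apply/val_inj => /=.
by rewrite widen_partE /= leq_ord !inord_val.
Qed.

Lemma big_widen_part (T : Type) (idx : T) (op : Monoid.law idx) e
    (F : nat -> nat -> T) : (forall i, F i 0%N = idx) ->
  \big[op/idx]_(i < N) F i (widen_part e i) =
  \big[op/idx]_(i < n.+1) F i (e i).
Proof.
move=> F0; transitivity (\big[op/idx]_(i < N)
   (if (i < n.+1)%N then F i (e (inord i)) else idx)).
  by apply: eq_bigr => i _; rewrite widen_partE ltnS; case: ifP.
rewrite -big_mkcond /= -(big_ord_widen _ (fun i => F i (e (inord i)))) //.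
by apply: eq_bigr => i _; rewrite inord_val.
Qed.

Lemma narrow_partK (e : {ffun 'I_N -> 'I_N.+1}) :
  (forall i, e i <= K)%N -> (forall i : 'I_N, n < i -> e i = 0%N :> nat)%N ->
  widen_part (narrow_part e) = e.
Proof.
move=> eK e0; apply/ffunP => i; apply/val_inj; rewrite /= widen_partE.
have [ni|/e0//] := leqP i n.
have ii : widen_ord nN (inord i) = i by apply: val_inj; rewrite /= inordK.
by rewrite ffunE ii inordK // ltnS.
Qed.

End Widen.

Lemma complete_bellE (R : realType) (x : nat -> R) N m :
  (0 < m)%N -> (m <= N)%N ->
  complete_bell m x = m`!%:R * bell_sum (fun i => x i.+1 / (i.+1)`!%:R) N m.
Proof.
case: m => // m _ mN; set y := fun i => _.
pose tot (e : {ffun 'I_N -> 'I_N.+1}) := (\sum_(i < N) e i)%N.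
have partial k : (1 <= k < m.+2)%N -> partial_bell m.+1 k x = (m.+1)`!%:R *
    \sum_(e : {ffun 'I_N -> 'I_N.+1} | (part_size e == m.+1) && (tot e == k))
      exp_weight y e.
  move=> /andP[k0 km]; rewrite ltnS in km.
  have nN : (m.+1 - k < N)%N by lia.
  have KN : (k <= N)%N by lia.
  rewrite /partial_bell.
  rewrite (reindex_onto (@widen_part (m.+1 - k) k N) (narrow_part k nN)); last first.
    move=> e /andP[/eqP sz /eqP te]; apply: narrow_partK => // i.
      by rewrite -te /tot (bigD1 i) //= leq_addr.
    move=> ki; apply/eqP; rewrite -leqn0 -ltnS ltnNge; apply/negP => ei.
    (* A part of size [i.+1] and [k - 1] further parts of size at least 1 have total size at least
       [k + i]; hence [i] cannot exceed [m.+1 - k]. *)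
    have : (tot e + i <= part_size e)%N.
      rewrite /part_size /tot (bigD1 i) //= [leqRHS](bigD1 i) //=.
      rewrite -addnA (addnC _ (nat_of_ord i)) addnA leq_add //; last first.
        by apply: leq_sum => j _; rewrite leq_pmull.
      by rewrite mulSn leq_add2l leq_pmulr.
    by rewrite sz te; lia.
  rewrite big_distrr /=; apply: eq_big => [e|e _].
    rewrite widen_partK // eqxx andbT /part_size /tot.
    rewrite (big_widen_part nN KN addn e (F := fun i j => i.+1 * j)%N); last first.
      by move=> i; rewrite muln0.
    by rewrite (big_widen_part nN KN addn e (F := fun _ j => j)) // andbC.
  rewrite /exp_weight.
  rewrite (big_widen_part nN KN *%R e (F := fun i j => y i ^+ j / j`!%:R)); last first.
    by move=> i; rewrite expr0 fact0 invr1 mulr1.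
  by rewrite big_split /= prodfV -mulrA; congr (_ * _); exact: mulrC.
rewrite /complete_bell (eq_big_nat _ _ partial) -big_distrr /=; congr (_ * _).
rewrite /bell_sum big_add1 big_mkord.
(* The terms are sorted by their number of parts, which lies between 1 and [m.+1]; the predecessor
   therefore fits the ordinal. *)
rewrite (partition_big (fun e => inord (tot e).-1 : 'I_m.+1) xpredT) //=.
apply: eq_bigr => k _; apply: eq_bigl => e.
have [/eqP sz/=|//] := boolP (part_size e == m.+1).
have tm : (tot e <= m.+1)%N by rewrite -sz sum_leq_part_size.
have t0 : (0 < tot e)%N.
  rewrite lt0n; apply/negP => /eqP/eqP; rewrite sum_nat_eq0 => /forallP /= e0.
  by move: sz; rewrite /part_size big1 => [//|i _]; rewrite (eqP (e0 i)) muln0.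
apply/eqP/eqP => [tk|/(congr1 val) /=]; last by rewrite inordK; lia.
by apply/val_inj; rewrite /= inordK; have := ltn_ord k; lia.
Qed.

(** * Logarithmic derivative of the q-product *)

Section QSeries.
Variables (R : realType) (rho : R).
Hypotheses (rho0 : 0 < rho) (rho1 : rho < 1).

Lemma onem_expr_gt0 n : 0 < 1 - rho ^+ n.+1.
Proof. by rewrite subr_gt0 exprn_ilt1 ?ltW. Qed.

(* Coefficientwise form of z B'(z) = B(z) * sum_(n >= 1) z^n / (1 - rho^n) for
   B(z) = sum_k b_k z^k = b_0 * prod_(j >= 0) 1 / (1 - z rho^j). *)
Lemma q_log_derivative (b : nat -> R) :
  (forall k, b k.+1 * (1 - rho ^+ k.+1) = b k) ->
  forall k, k.+1%:R * b k.+1 = \sum_(n < k.+1) b (k - n)%N / (1 - rho ^+ n.+1).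
Proof.
move=> bS k; have nz n : 1 - rho ^+ n.+1 != 0 by rewrite gt_eqF ?onem_expr_gt0.
have geo j : \sum_(n < j.+1) rho ^+ n * b n = b j.
  elim: j => [|j IH]; first by rewrite big_ord1 expr0 mul1r.
  by rewrite big_ord_recr /= IH -bS; ring.
elim: k => [|k IH].
  by rewrite big_ord1 subn0 mul1r -(bS 0%N) mulfK.
(* With u = rho^(k+1-n) and v = rho^(n+1), the factor 1 - rho^(k+2) is 1 - uv = (1 - u) + u(1 - v).
   The first half gives the induction hypothesis through [bS], the second sums to [b k.+1] by
   [geo]. *)
apply: (mulIf (nz k.+1)); rewrite -mulrA bS -[X in X%:R]addn1 natrD mulrDl mul1r IH.
rewrite big_distrl /= [RHS](eq_bigr (fun n : 'I_k.+2 =>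
  b (k.+1 - n)%N * (1 - rho ^+ (k.+1 - n)) / (1 - rho ^+ n.+1)
   + rho ^+ (k.+1 - n) * b (k.+1 - n)%N)); last first.
  move=> n _; have -> : rho ^+ k.+2 = rho ^+ (k.+1 - n) * rho ^+ n.+1.
    by rewrite -exprD; congr (_ ^+ _); have := ltn_ord n; lia.
  by have := nz n; move: (rho ^+ n.+1) => r r1; field.
rewrite big_split /=; congr (_ + _).
  rewrite [RHS]big_ord_recr /= subnn expr0 subrr mulr0 mul0r addr0.
  apply: eq_bigr => n _; congr (_ / _).
  by rewrite subSn ?bS //; have := ltn_ord n; rewrite ltnS.
by rewrite -[LHS]geo (reindex_inj rev_ord_inj) /=; apply: eq_bigr => n _; rewrite subSS.
Qed.

End QSeries.

(** * Convergence of the series defining kappa *)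

Section Summability.
Variables (R : realType) (rho : R).
Hypotheses (rho0 : 0 < rho) (rho1 : rho < 1).

(** With s = sqrt r, r^n = s^n s^n: one factor goes to the induction hypothesis, the other absorbs
    the extra n, because n s^n is at most 1 + s + ... + s^(n-1). *)
Lemma poly_geometric_bounded j (r : R) : 0 < r -> r < 1 ->
  exists2 C, 0 <= C & forall n : nat, n%:R ^+ j * r ^+ n <= C.
Proof.
elim: j r => [|j IH] r r0 r1.
  by exists 1 => // n; rewrite expr0 mul1r exprn_ile1 ?ltW.
have s0 : 0 < Num.sqrt r by rewrite sqrtr_gt0.
have s1 : Num.sqrt r < 1 by rewrite -sqrtr1 ltr_sqrt.
have [C C0 HC] := IH _ s0 s1.
have lin (n : nat) : n%:R * Num.sqrt r ^+ n <= (1 - Num.sqrt r)^-1.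
  rewrite -[leRHS]div1r ler_pdivlMr ?subr_gt0 //; set s := Num.sqrt r in s0 s1 *.
  have geo : (1 - s) * \sum_(i < n) s ^+ i = 1 - s ^+ n.
    by rewrite -opprB mulNr -subrX1 opprB.
  have : n%:R * s ^+ n <= \sum_(i < n) s ^+ i.
    rewrite -[n in n%:R]card_ord mulr_natl -sumr_const; apply: ler_sum => i _.
    by apply: ler_wiXn2l; rewrite ?ltW // ltnW.
  have : 0 < s ^+ n by rewrite exprn_gt0.
  have s1' : 0 <= 1 - s by rewrite subr_ge0 ltW.
  move=> sn0 /(ler_wpM2l s1'); rewrite geo mulrC => /le_trans; apply.
  by lra.
exists (C * (1 - Num.sqrt r)^-1); first by rewrite mulr_ge0 // invr_ge0 subr_ge0 ltW.
move=> n; rewrite -[r in r ^+ n]sqr_sqrtr ?(ltW r0) // -exprM mul2n -addnn exprD exprSr.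
by rewrite mulrACA; apply: ler_pM.
Qed.

Lemma poly_geometric_summable j :
  cvgn (series (fun n : nat => n%:R ^+ j * rho ^+ n)).
Proof.
have s0 : 0 < Num.sqrt rho by rewrite sqrtr_gt0.
have s1 : Num.sqrt rho < 1 by rewrite -sqrtr1 ltr_sqrt.
have [C C0 HC] := poly_geometric_bounded j s0 s1.
apply: (@series_le_cvg _ _ (geometric C (Num.sqrt rho))) => [n|n|n|].
- by rewrite mulr_ge0 ?exprn_ge0 ?(ltW rho0).
- by rewrite /= mulr_ge0 // exprn_ge0 // ltW.
- rewrite /= -[rho in rho ^+ n]sqr_sqrtr ?(ltW rho0) // -exprM mul2n -addnn exprD mulrA.
  by rewrite ler_wpM2r // exprn_ge0 // ltW.
- by apply: is_cvg_geometric_series; rewrite ger0_norm // ltW.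
Qed.

(** [kappa] is a limit of real partial sums, so it must be shown to converge before it can be used
    as an extended-real series; the index is shifted to start at 0. *)
Lemma kappaE j :
  (kappa rho j.+1)%:E =
  (\sum_(n <oo) (n.+1%:R ^+ j * rho ^+ n.+1 / (1 - rho ^+ n.+1))%:E)%E.
Proof.
pose f (k : nat) : R := k%:R ^+ j * rho ^+ k / (1 - rho ^+ k).
have f0 k : 0 <= f k.
  rewrite /f mulr_ge0 // ?mulr_ge0 ?exprn_ge0 ?invr_ge0 ?subr_ge0 ?(ltW rho0) //.
  by rewrite exprn_ile1 // ltW.
have cf : cvgn (series f).
  apply: (@series_le_cvg _ _ (fun k => (1 - rho)^-1 * (k%:R ^+ j * rho ^+ k))) => // n.
  - by rewrite mulr_ge0 ?mulr_ge0 ?exprn_ge0 ?invr_ge0 ?subr_ge0 ?(ltW rho0) // ltW.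
  (* At index 0 the denominator is 0, whose inverse is 0 by convention, so the term vanishes. *)
  - case: n => [|n]; first rewrite /f expr0 subrr invr0 mulr0.
      by rewrite mulr_ge0 ?mulr_ge0 ?exprn_ge0 ?invr_ge0 ?subr_ge0 ?(ltW rho0) // ltW.
    rewrite /f mulrC ler_wpM2r ?mulr_ge0 ?exprn_ge0 ?(ltW rho0) //.
    rewrite lef_pV2 ?posrE ?onem_expr_gt0 ?subr_gt0 // lerB //.
    by rewrite exprS ler_piMr ?(ltW rho0) // exprn_ile1 // ltW.
  - rewrite (_ : series _ = (fun=> (1 - rho)^-1) \*
        series (fun k : nat => k%:R ^+ j * rho ^+ k)).
      by apply: is_cvgMl_tmp; exact: poly_geometric_summable.
    by apply/funext => N; rewrite /series /= mulr_sumr.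
have cf1 : cvgn (fun n => \sum_(1 <= k < n) f k).
  rewrite (_ : (fun _ => _) = series f) //; apply/funext => -[|n].
    by rewrite /series /= !big_geq.
  by rewrite /series /= [RHS]big_ltn // {2}/f expr0 subrr invr0 mulr0 add0r.
rewrite /kappa -EFin_lim //; 
rewrite (_ : EFin \o _ = (fun n => \sum_(1 <= k < n) (f k)%:E)%E); last first.
  by apply/funext => n; rewrite /= sumEFin.
by rewrite -(@nneseries_addn _ (fun k => (f k)%:E) 1);
  [apply: eq_eseriesr => n _; rewrite addn1|move=> n; rewrite lee_fin].
Qed.

End Summability.

(** * Recurrence of the moments *)

Lemma nneseries_cauchy_product (R : realType) (f : nat -> nat -> \bar R) :
  (forall i j, 0 <= f i j)%E ->
  (\sum_(k <oo) \sum_(n < k.+1) f n (k - n)%N = \sum_(n <oo) \sum_(l <oo) f n l)%E.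
Proof.
move=> f0; pose g k n : \bar R := if (n <= k)%N then f n (k - n)%N else 0%E.
have g0 k n : (0 <= g k n)%E by rewrite /g; case: ifP.
transitivity (\sum_(k <oo) \sum_(n <oo) g k n)%E.
  apply: eq_eseriesr => k _; rewrite (nneseries_split 0 k.+1) // add0n.
  rewrite big_mkord eseries0 ?adde0 => [|i ki _]; last by rewrite /g leqNgt ki.
  by apply: eq_bigr => n _; rewrite /g -ltnS ltn_ord.
rewrite nneseries_interchange //; apply: eq_eseriesr => n _.
rewrite (nneseries_split 0 n) // add0n big_mkord big1 ?add0e => [|i _]; last first.
  by rewrite /g leqNgt ltn_ord.
rewrite -nneseries_addn //; apply: eq_eseriesr => l _.
by rewrite /g leq_addl addnK.
Qed.

Section Moments.
Variables (R : realType) (rho : R).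
Hypotheses (rho0 : 0 < rho) (rho1 : rho < 1).
Variable a : nat -> R.
Hypotheses (a_ge0 : forall k, 0 <= a k)
  (aS : forall k, a k.+1 * (1 - rho ^+ k.+1) = rho * a k).

Definition moment m : \bar R := (\sum_(k <oo) (k%:R ^+ m * a k)%:E)%E.

(** The sequence a_k / rho^k satisfies the hypothesis of [q_log_derivative]; the powers of rho are
    then restored. *)
Lemma a_log_derivative k : k.+1%:R * a k.+1 =
  \sum_(n < k.+1) rho ^+ n.+1 / (1 - rho ^+ n.+1) * a (k - n)%N.
Proof.
have rn n : rho ^+ n != 0 by rewrite expf_neq0 // gt_eqF.
have bS j : a j.+1 / rho ^+ j.+1 * (1 - rho ^+ j.+1) = a j / rho ^+ j.
  by rewrite mulrAC aS exprS invfM mulrACA divff ?mul1r // gt_eqF.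
have := q_log_derivative rho0 rho1 bS k; rewrite mulrA => /(canRL (divfK (rn _))) ->.
rewrite big_distrl /=; apply: eq_bigr => n _.
have -> : rho ^+ k.+1 = rho ^+ (k - n) * rho ^+ n.+1.
  by rewrite -exprD; congr (_ ^+ _); have := ltn_ord n; lia.
have := onem_expr_gt0 rho0 rho1 n => /gt_eqF /negbT.
have := rn (k - n)%N; move: (rho ^+ n.+1) (rho ^+ _) => u v v0 u0.
by field; rewrite u0 v0.
Qed.

(** In [a_log_derivative], k + 1 = (n + 1) + l with l = k - n; the binomial theorem separates n from
    l, and the Cauchy product yields kappa times a moment. Finiteness lets the lower moments leave
    the series as real factors. *)
Lemma momentS m : (forall j, (j <= m)%N -> moment j \is a fin_num) ->
  moment m.+1 =
  (\sum_(i < m.+1) ('C(m, i)%:R * kappa rho i.+1)%:E * moment (m - i))%E.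
Proof.
move=> m_fin; have [u uE] : exists u : nat -> R,
    forall n, u n = rho ^+ n.+1 / (1 - rho ^+ n.+1).
  by eexists.
have u_ge0 n : 0 <= u n.
  by rewrite uE mulr_ge0 ?exprn_ge0 ?invr_ge0 ?(ltW rho0) // ltW // onem_expr_gt0.
pose g i n l : R := 'C(m, i)%:R * (n.+1%:R ^+ i * u n) * (l%:R ^+ (m - i) * a l).
have g_ge0 i n l : 0 <= g i n l by rewrite !mulr_ge0 ?exprn_ge0.
pose f n l : \bar R := (\sum_(i < m.+1) (g i n l)%:E)%E.
have f_ge0 n l : (0 <= f n l)%E by apply: sume_ge0 => i _; rewrite lee_fin.
have term k : ((k.+1%:R ^+ m.+1 * a k.+1)%:E = \sum_(n < k.+1) f n (k - n)%N)%E.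
  rewrite exprSr -mulrA a_log_derivative big_distrr /= -sumEFin.
  apply: eq_bigr => n _; rewrite /f sumEFin; congr EFin.
  have -> : k.+1%:R = (k - n)%N%:R + n.+1%:R :> R.
    by rewrite -natrD; congr (_%:R); have := ltn_ord n; lia.
  rewrite exprDn big_distrl /=; apply: eq_bigr => i _.
  by rewrite /g uE -mulr_natl; ring.
rewrite [LHS]/moment (nneseries_split 0 1); last first.
  by move=> k _; rewrite lee_fin mulr_ge0 ?exprn_ge0.
rewrite add0n big_nat1 expr0n mul0r add0e -nneseries_addn; last first.
  by move=> k; rewrite lee_fin mulr_ge0 ?exprn_ge0.
under eq_eseriesr => k _ do rewrite addn1 term.
rewrite nneseries_cauchy_product //.
under eq_eseriesr => n _.
  rewrite /f nneseries_sum; last by move=> i l _; rewrite lee_fin.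
  under eq_bigr => i _.
    under eq_eseriesr => l _ do rewrite /g EFinM.
    rewrite nneseriesZl; last by move=> l _; rewrite lee_fin mulr_ge0 ?exprn_ge0.
    rewrite -[X in (_ * X)%E]/(moment (m - i)).
    over.
  over.
have m_ge0 j : (0 <= moment j)%E.
  by apply: nneseries_ge0 => l _ _; rewrite lee_fin mulr_ge0 ?exprn_ge0.
rewrite nneseries_sum; last first.
  move=> i n _; rewrite mule_ge0 ?m_ge0 // lee_fin mulr_ge0 //.
  by rewrite mulr_ge0 ?exprn_ge0 ?u_ge0.
apply: eq_bigr => i _.
have u_term n : n.+1%:R ^+ i * rho ^+ n.+1 / (1 - rho ^+ n.+1) = n.+1%:R ^+ i * u n.
  by rewrite uE mulrA.
rewrite EFinM kappaE // -nneseriesZl => [|n _]; last first.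
  by rewrite lee_fin u_term mulr_ge0 ?exprn_ge0.
rewrite muleC -(fineK (m_fin _ (leq_subr i m))) -nneseriesZl => [|n _]; last first.
  by rewrite -EFinM lee_fin u_term mulr_ge0 // mulr_ge0 ?exprn_ge0.
by apply: eq_eseriesr => n _; rewrite u_term -EFinM muleC.
Qed.

Hypothesis a_sum1 : (\sum_(k <oo) (a k)%:E = 1)%E.

(** Strong induction: the real value obtained for the lower moments is also the finiteness that
    [momentS] asks for. *)
Lemma moment_bell N m : (m <= N)%N ->
  moment m = (m`!%:R * bell_sum (fun i => kappa rho i.+1 / (i.+1)`!%:R) N m)%:E.
Proof.
set y := fun i => _; elim/ltn_ind: m => -[|m] IH mN.
  rewrite bell_sum0 mulr1 fact0 -a_sum1 /moment.
  by apply: eq_eseriesr => k _; rewrite expr0 mul1r.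
rewrite momentS => [|j jm]; last by rewrite IH // (leq_trans jm) // ltnW.
rewrite factS mulnC natrM -mulrA bell_sumS // big_distrr /= -sumEFin.
apply: eq_bigr => i _; have im : (i <= m)%N by rewrite -ltnS.
rewrite IH; [|by rewrite ltnS leq_subr|by rewrite (leq_trans (leq_subr _ _)) // ltnW].
rewrite -EFinM; congr EFin; rewrite -(bin_fact im) /y factS !natrM.
have := fact_gt0 i; rewrite -(ltr0n R) => /gt_eqF/negbT.
by move: (bell_sum _ _ _) => S i0; field; rewrite i0 nat1r pnatr_eq0.
Qed.

End Moments.

(* The walk started from [h] with the directions [c x n], [c x n.+1], ... stays
   positive for [N] steps; a step in direction [b] counts as [+1]. With [b] the
   direction away from a barrier, [h] is the distance to it. *)
Fixpoint surv (b : bool) (c : nat -> nat -> bool) x n N h : bool :=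
  (0 < h)%N && if N is N'.+1 then
    surv b c x n.+1 N' (if c x n == b then h.+1 else h.-1) else true.

Lemma survS b c x n N h : surv b c x n N.+1 h =
  (0 < h)%N && surv b c x n.+1 N (if c x n == b then h.+1 else h.-1).
Proof. by []. Qed.

(** * Gambler's ruin *)

Section SurvProb.
Variables (R : realType) (r : R).
Hypotheses (r0 : 0 < r) (r1 : r < 1).

(** First-step recursion for the probability that a walk from height [h], going up with probability
    [r], stays positive during [N] steps; [prob_surv_cyl] makes the link with [P]. *)
Fixpoint surv_prob N (h : nat) : R :=
  if h is h'.+1 then
    if N is N'.+1 then r * surv_prob N' h'.+2 + (1 - r) * surv_prob N' h'
    else 1
  else 0.

Lemma surv_prob0 N : surv_prob N 0 = 0. Proof. by case: N. Qed.

Lemma surv_probS N h : surv_prob N.+1 h.+1 =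
  r * surv_prob N h.+2 + (1 - r) * surv_prob N h.
Proof. by []. Qed.

Lemma surv_prob_itv N h : 0 <= surv_prob N h <= 1.
Proof.
elim: N h => [|N IH] [|h] /=; rewrite ?lexx ?ler01 //.
have := IH h.+2; have := IH h; move: (surv_prob _ _) (surv_prob _ _) => u v.
by have := r0; have := r1; nra.
Qed.

Lemma surv_prob_noninc h : nonincreasing_seq (surv_prob ^~ h).
Proof.
apply/nonincreasing_seqP => N; elim: N h => [|N IH] [|h] //.
  by case/andP: (surv_prob_itv 1 h.+1).
by rewrite surv_probS [leRHS]surv_probS lerD //
  ler_wpM2l ?subr_ge0 ?(ltW r0) ?(ltW r1) //; exact: IH.
Qed.

Definition surv_lim h : R := limn (surv_prob ^~ h).

Lemma surv_prob_cvg h : surv_prob ^~ h @ \oo --> surv_lim h.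
Proof.
apply: nonincreasing_is_cvgn; first exact: surv_prob_noninc.
by exists 0 => _ [N _ <-]; case/andP: (surv_prob_itv N h).
Qed.

Lemma surv_lim_itv h : 0 <= surv_lim h <= 1.
Proof.
apply/andP; split.
  by apply: (limr_ge (cvgP _ (@surv_prob_cvg h))); apply: nearW => N;
    case/andP: (surv_prob_itv N h).
by apply: (limr_le (cvgP _ (@surv_prob_cvg h))); apply: nearW => N;
  case/andP: (surv_prob_itv N h).
Qed.

Lemma surv_lim0 : surv_lim 0 = 0.
Proof.
rewrite /surv_lim (_ : surv_prob ^~ 0%N = cst 0) ?lim_cst //.
by apply/funext => N; rewrite surv_prob0.
Qed.

Lemma surv_limS h :
  surv_lim h.+1 = r * surv_lim h.+2 + (1 - r) * surv_lim h.
Proof.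
have lhs : surv_prob N.+1 h.+1 @[N --> \oo] --> surv_lim h.+1.
  by rewrite (cvg_shiftS (surv_prob ^~ h.+1)); exact: surv_prob_cvg.
have rhs : surv_prob N.+1 h.+1 @[N --> \oo] -->
    r * surv_lim h.+2 + (1 - r) * surv_lim h.
  by apply: cvgD; apply: cvgMl_tmp; exact: surv_prob_cvg.
exact: (cvg_unique (@norm_hausdorff R R) lhs rhs).
Qed.

(* The increments of a harmonic function form a geometric progression. *)
Lemma surv_limE h :
  surv_lim h = surv_lim 1 * \sum_(i < h) ((1 - r) / r) ^+ i.
Proof.
have r_neq0 : r != 0 by rewrite gt_eqF.
have incr k : surv_lim k.+1 - surv_lim k = surv_lim 1 * ((1 - r) / r) ^+ k.
  elim: k => [|k IH]; first by rewrite surv_lim0 subr0 expr0 mulr1.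
  rewrite exprS mulrCA -IH; apply: (mulfI r_neq0).
  have q : r * ((1 - r) / r) = 1 - r by rewrite mulrC divfK.
  rewrite /= [RHS]mulrA q.
  by have := surv_limS k; lra.
elim: h => [|h IH]; first by rewrite big_ord0 mulr0 surv_lim0.
by rewrite big_ord_recr /= mulrDr -IH -incr; ring.
Qed.

End SurvProb.

Section SurvLim.
Variables (R : realType) (rho : R).
Hypotheses (rho0 : 0 < rho) (rho1 : rho < 1).
Let p : R := 1 / (1 + rho).

Lemma drift_gt0 : 0 < p. Proof. by rewrite divr_gt0 // addr_gt0. Qed.

Lemma drift_lt1 : p < 1.
Proof. by rewrite ltr_pdivrMr ?addr_gt0 // mul1r ltrDl. Qed.

Lemma drift_ratio : (1 - p) / p = rho.
Proof. by rewrite /p; field; rewrite gt_eqF ?addr_gt0. Qed.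

(** The left side is harmonic for the walk with drift, so the inequality at horizon 0 propagates
    through the recursion. *)
Lemma surv_prob_lower N h : 1 - rho ^+ h <= surv_prob p N h.
Proof.
elim: N h => [|N IH] [|h]; rewrite ?expr0 ?subrr ?surv_prob0 //.
  by rewrite /= lerBlDr lerDl exprn_ge0 // ltW.
rewrite surv_probS.
have -> : 1 - rho ^+ h.+1 = p * (1 - rho ^+ h.+2) + (1 - p) * (1 - rho ^+ h).
  by rewrite !exprS /p; field; rewrite gt_eqF ?addr_gt0.
by rewrite lerD // ler_wpM2l ?subr_ge0 ?(ltW drift_gt0) ?(ltW drift_lt1).
Qed.

(** By [surv_limE] only the value at 1 is unknown. It is at least 1 - rho by [surv_prob_lower], and
    at most that because the limits stay below 1 as the height grows. *)
Lemma surv_lim_right h : surv_lim p h = 1 - rho ^+ h.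
Proof.
have limE k := surv_limE drift_gt0 drift_lt1 k.
have geo k : (1 - rho) * \sum_(i < k) rho ^+ i = 1 - rho ^+ k.
  by rewrite -opprB mulNr -subrX1 opprB.
suff s1 : surv_lim p 1 = 1 - rho by rewrite limE drift_ratio s1 geo.
have cvgs k := @surv_prob_cvg _ _ drift_gt0 drift_lt1 k.
apply/eqP; rewrite eq_le; apply/andP; split; last first.
  apply: (limr_ge (cvgP _ (@cvgs 1))); apply: nearW => N.
  by rewrite -[X in 1 - X]expr1 surv_prob_lower.
have c : surv_lim p 1 * (1 - rho ^+ k) @[k --> \oo] --> surv_lim p 1 * (1 - 0).
  by apply: cvgMl_tmp; apply: cvgB; [exact: cvg_cst|];
    apply: cvg_expr; rewrite ger0_norm ?ltW.
rewrite -[leLHS]mulr1 -[X in _ * X](subr0 1) -(cvg_lim (@norm_hausdorff R R) c).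
apply: (limr_le (cvgP _ c)); apply: nearW => k.
rewrite -geo mulrCA -[leRHS]mulr1 ler_wpM2l ?subr_ge0 ?(ltW rho1) //.
have := limE k; rewrite drift_ratio => <-.
by case/andP: (surv_lim_itv drift_gt0 drift_lt1 k).
Qed.

(** Here the increments have ratio 1/rho > 1, so a positive value s at 1 would give at least k s at
    height k, contradicting the bound 1 once k > 1/s. *)
Lemma surv_lim_left h : surv_lim (1 - p) h = 0.
Proof.
have r0 : 0 < 1 - p by rewrite subr_gt0 drift_lt1.
have r1 : 1 - p < 1 by rewrite ltrBlDr ltrDl drift_gt0.
have limE k := surv_limE r0 r1 k.
suff s1 : surv_lim (1 - p) 1 = 0 by rewrite limE s1 mul0r.
apply/eqP; rewrite eq_le; case/andP: (surv_lim_itv r0 r1 1) => -> _.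
rewrite andbT leNgt; apply/negP; set s := surv_lim _ _ in limE *; move=> s0.
have := archi_boundP (ltW (_ : 0 < s^-1)); rewrite invr_gt0 => /(_ s0).
set k := Num.bound _; rewrite -[X in X < _]div1r ltr_pdivrMr //.
apply/negP; rewrite -leNgt.
have := limE k; case/andP: (surv_lim_itv r0 r1 k) => _ + e; rewrite e.
apply: le_trans; rewrite mulrC ler_wpM2l ?(ltW s0) //.
rewrite -[k in k%:R]card_ord -sumr_const; apply: ler_sum => i _.
have -> : (1 - (1 - p)) / (1 - p) = rho^-1.
  by rewrite -[rho]drift_ratio invf_div; congr (_ / _); ring.
by rewrite exprn_ege1 // invf_ge1 ?ltW.
Qed.

End SurvLim.

Lemma survE b c x n N h : reflect
  (forall j, (j <= N)%N -> 0 < h%:Z + \sum_(n <= i < n + j) step_of (c x i == b))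
  (surv b c x n N h).
Proof.
elim: N n h => [|N IH] n h.
  apply: (iffP idP) => /= [h0 j|/(_ 0%N)].
    by rewrite leqn0 => /eqP ->; rewrite addn0 big_geq // addr0 andbT in h0 *.
  by rewrite addn0 big_geq // addr0 andbT => /(_ isT).
have sumS j : \sum_(n <= i < n + j.+1) step_of (c x i == b) =
    step_of (c x n == b) + \sum_(n.+1 <= i < n.+1 + j) step_of (c x i == b).
  by rewrite big_ltn ?addnS ?addSn ?ltnS ?leq_addr.
have hS : (0 < h)%N ->
   (if c x n == b then h.+1 else h.-1)%:Z = h%:Z + step_of (c x n == b).
  by case: h => // h _; rewrite /step_of; case: (_ == b); lia.
rewrite survS; apply: (iffP andP) => [[h0 /IH surv'] [_|j]|pos].
- by rewrite addn0 big_geq // addr0.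
- by rewrite ltnS sumS addrA -hS // => /surv'.
have h0 : (0 < h)%N by have := pos 0%N isT; rewrite addn0 big_geq // addr0.
split=> //; apply/IH => j jN; rewrite hS // -addrA -sumS; exact: pos.
Qed.

(** Unit steps cannot leave the positive heights without passing through 0. *)
Lemma surv_hit b c x n N h : ~~ surv b c x n N h ->
  exists j, h%:Z + \sum_(n <= i < n + j) step_of (c x i == b) = 0.
Proof.
elim: N n h => [|N IH] n h.
  by case: h => // _; exists 0%N; rewrite addn0 big_geq.
rewrite survS; case: h => [_|h /=]; first by exists 0%N; rewrite addn0 big_geq.
move=> /IH [j jE]; exists j.+1; rewrite -[RHS]jE big_ltn ?addnS ?addSn ?ltnS ?leq_addr //.
by rewrite addrA; congr (_ + _); rewrite /step_of; case: (_ == b); lia.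
Qed.

Lemma survSW b c x n N h : surv b c x n N.+1 h -> surv b c x n N h.
Proof. by move=> /survE s; apply/survE => j jN; apply: s; rewrite leqW. Qed.

(** * Survival events of successive frogs and their independence *)

Section FrogProb.
Variables (R : realType) (d : measure_display) (T : measurableType d).
Variables (P : probability T R) (p : R) (xi : nat * nat -> {RV P >-> bool}).
Hypothesis hxi : frog_steps p xi.

Let dirs (w : T) x i := xi (x, i) w.
Let q (b : bool) : R := if b then p else 1 - p.

Lemma measurable_xi a (B : set bool) : measurable (xi a @^-1` B).
Proof. by rewrite -[X in measurable X]setTI; exact: measurable_funP. Qed.

Lemma prob_xi a b : P (xi a @^-1` [set b]) = (q b)%:E.
Proof.
case: hxi => [up [down _]]; case: b; [rewrite -(up a)|rewrite -(down a)];
  by congr (P _); apply/seteqP; split => w /=; rewrite /step_of; case: (xi a w).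
Qed.

Definition cyl (J : {fset nat * nat}) (f : nat * nat -> bool) : set T :=
  \bigcap_(a in [set` J]) (xi a @^-1` [set f a]).

Lemma measurable_cyl J f : measurable (cyl J f).
Proof. by apply: fin_bigcap_measurable => // a _; exact: measurable_xi. Qed.

Lemma prob_cyl J f : P (cyl J f) = (\prod_(a <- J) q (f a))%:E.
Proof.
case: hxi => _ [_ /(_ J (fun a => [set f a]) (fun=> I)) ->].
by rewrite -prodEFin; apply: eq_bigr => a _; exact: prob_xi.
Qed.

Lemma cyl_add a J f b : a \notin J ->
  cyl (a |` J)%fset (fun a' => if a' == a then b else f a') =
  xi a @^-1` [set b] `&` cyl J f.
Proof.
move=> aJ; rewrite /cyl bigcap_fsetU1 eqxx; congr (_ `&` _).
by apply: eq_bigcapr => a' /= a'J; case: eqVneq => // e; rewrite -e a'J in aJ.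
Qed.

Lemma prod_add a (J : {fset nat * nat}) (f : nat * nat -> bool) b : a \notin J ->
  \prod_(a' <- (a |` J)%fset) q (if a' == a then b else f a') =
  q b * \prod_(a' <- J) q (f a').
Proof.
move=> aJ; rewrite big_fsetU1 //= eqxx; congr (_ * _).
rewrite big_seq [RHS]big_seq; apply: eq_bigr => a' a'J.
by case: eqVneq => // e; rewrite -e a'J in aJ.
Qed.

(* [G] has probability [g] and is independent of the frogs from [M] on. *)
Definition indep_from M (G : set T) (g : R) : Prop :=
  measurable G /\ forall (J : {fset nat * nat}) f,
    (forall a, a \in J -> (M <= a.1)%N) ->
    P (G `&` cyl J f) = (g * \prod_(a <- J) q (f a))%:E.

Definition surv_event b x n N h : set T := [set w | surv b (dirs w) x n N h].

Lemma surv_eventS b x n N h : surv_event b x n N.+1 h.+1 =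
  (xi (x, n) @^-1` [set b] `&` surv_event b x n.+1 N h.+2) `|`
  (xi (x, n) @^-1` [set ~~ b] `&` surv_event b x n.+1 N h).
Proof.
rewrite /surv_event /dirs; apply/seteqP; split => w /=; move: (xi (x, n) w) => e.
  by case: e b => [] [] s; [left|right|right|left].
by case: e b => [] [] [[]|[]].
Qed.

Lemma measurable_surv b x n N h : measurable (surv_event b x n N h).
Proof.
elim: N n h => [|N IH] n [|h].
- by rewrite (_ : surv_event _ _ _ _ _ = set0) //; apply/seteqP; split.
- by rewrite (_ : surv_event _ _ _ _ _ = setT) //; apply/seteqP; split.
- by rewrite (_ : surv_event _ _ _ _ _ = set0) //; apply/seteqP; split.
- by rewrite surv_eventS; apply: measurableU; apply: measurableI => //;
    exact: measurable_xi.
Qed.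

(** Induction on the horizon: step [n] of frog [M] is revealed and recorded in the cylinder. The
    condition on [J] allows only later frogs and earlier steps of frog [M], so that the revealed
    step is fresh. *)
Lemma prob_surv_cyl M G g b N n h (J : {fset nat * nat}) f : indep_from M G g ->
  (forall a, a \in J -> (M <= a.1)%N && ((a.1 == M) ==> (a.2 < n)%N)) ->
  P (G `&` surv_event b M n N h `&` cyl J f) =
  (g * surv_prob (q b) N h * \prod_(a <- J) q (f a))%:E.
Proof.
move=> [mG iG]; elim: N n h J f => [|N IH] n [|h] J f Jn.
- rewrite (_ : surv_event _ _ _ _ _ = set0); last by apply/seteqP; split.
  by rewrite setI0 set0I measure0 mulr0 mul0r.
- rewrite (_ : surv_event _ _ _ _ _ = setT); last by apply/seteqP; split.
  by rewrite setIT mulr1 iG // => a /Jn /andP[].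
- rewrite (_ : surv_event _ _ _ _ _ = set0); last by apply/seteqP; split.
  by rewrite setI0 set0I measure0 surv_prob0 mulr0 mul0r.
have aJ : (M, n) \notin J by apply/negP => /Jn /=; rewrite leqnn eqxx ltnn.
pose f' c a' := if a' == (M, n) then c else f a'.
have split_event : G `&` surv_event b M n N.+1 h.+1 `&` cyl J f =
  (G `&` surv_event b M n.+1 N h.+2 `&` cyl ((M, n) |` J)%fset (f' b)) `|`
  (G `&` surv_event b M n.+1 N h `&` cyl ((M, n) |` J)%fset (f' (~~ b))).
  rewrite !cyl_add // surv_eventS; apply/seteqP; split => w /=; tauto.
have Jn' a : a \in ((M, n) |` J)%fset ->
    (M <= a.1)%N && ((a.1 == M) ==> (a.2 < n.+1)%N).
  rewrite !inE => /orP[/eqP -> /=|/Jn]; first by rewrite leqnn ltnSn implybT.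
  by case/andP => -> /= /implyP aM; apply/implyP => /aM /ltnW; rewrite ltnS.
rewrite split_event measureU; first last.
- rewrite !cyl_add //; apply/seteqP; split => w //= [[_ [-> _]] [_ [+ _]]].
  by case: b {split_event IH f'}.
- by do 2?apply: measurableI => //; [exact: measurable_surv|exact: measurable_cyl].
- by do 2?apply: measurableI => //; [exact: measurable_surv|exact: measurable_cyl].
apply: etrans (congr2 adde (IH _ _ _ _ Jn') (IH _ _ _ _ Jn')) _.
rewrite surv_probS !prod_add // [LHS]/=.
have -> : q (~~ b) = 1 - q b by rewrite /q; case: b {split_event IH f'} => //=; ring.
by congr EFin; ring.
Qed.

Lemma indep_fromT : indep_from 0 setT 1.
Proof. by split=> // J f _; rewrite setTI mul1r prob_cyl. Qed.

Lemma indep_from_surv M G g b N h : indep_from M G g ->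
  indep_from M.+1 (G `&` surv_event b M 0 N h) (g * surv_prob (q b) N h).
Proof.
move=> iG; split; first by apply: measurableI; [case: iG|exact: measurable_surv].
move=> J f JM; rewrite (@prob_surv_cyl M G g b N 0 h J f iG) // => a /JM aM.
by rewrite ltnW //= gtn_eqF.
Qed.

Lemma indep_from_prob M G g : indep_from M G g -> P G = g%:E.
Proof.
case=> _ /(_ fset0 (fun=> true)); rewrite /cyl set_fset0 bigcap_set0 setIT.
by move=> ->; rewrite ?big_seq_fset0 ?mulr1 // => a; rewrite inE.
Qed.

(** Frog [x] starts at distance [k.+1 + x] from the barrier -(k+1), so survival means visiting no
    site below -k. *)
Definition surv_upto k N M : set T :=
  [set w | forall x, (x < M)%N -> surv true (dirs w) x 0 N (k.+1 + x)].

Lemma surv_uptoS k N M :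
  surv_upto k N M.+1 = surv_upto k N M `&` surv_event true M 0 N (k.+1 + M).
Proof.
apply/seteqP; split => w /= => [s|[s sM] x].
  by split => [x xM|]; apply: s => //; exact: leqW.
by rewrite ltnS leq_eqVlt => /predU1P[->//|]; exact: s.
Qed.

Lemma indep_surv_upto k N M :
  indep_from M (surv_upto k N M) (\prod_(x < M) surv_prob p N (k.+1 + x)).
Proof.
elim: M => [|M IH]; last first.
  by rewrite big_ord_recr /= surv_uptoS; exact: indep_from_surv.
rewrite big_ord0 (_ : surv_upto k N 0 = setT); first exact: indep_fromT.
by apply/seteqP; split.
Qed.

Lemma prob_surv_left N h : P (surv_event false 0 0 N h) = (surv_prob (1 - p) N h)%:E.
Proof.
by have := indep_from_prob (indep_from_surv false N h indep_fromT);
  rewrite setTI mul1r.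
Qed.

End FrogProb.

(** * Pathwise facts: waking up, visited sites and their minimum *)

Lemma walkS c x n : walk c x n.+1 = walk c x n + step_of (c x n).
Proof. by rewrite /walk big_ord_recr addrA. Qed.

Lemma walk0 c x : walk c x 0 = x%:Z.
Proof. by rewrite /walk big_ord0 addr0. Qed.

Section Dynamics.
Variable c : nat -> nat -> bool.

Lemma age_after t s x n : age c t x = Some n -> age c (s + t) x = Some (s + n)%N.
Proof. by move=> tx; elim: s => //= s ->. Qed.

Lemma age_origin t : age c t 0 = Some t.
Proof. by have := @age_after 0 t 0 0 erefl; rewrite !addn0. Qed.

Lemma age_awake t x n : age c t x = Some n -> exists t', age c t' x = Some 0%N.
Proof.
elim: t n => [|t IH] n /=.
  by case: eqP => // -> _; exists 0%N.
case e: (age c t x) => [n'|]; first by move=> _; exact: IH e.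
by case: ifP => // wk _; exists t.+1; rewrite /= e wk.
Qed.

(** The origin's frog has made exactly t steps at time t, so when its walk is at [x] the frog there
    is either awake already or woken at that moment. *)
Lemma all_awake x : (exists n, walk c 0 n = x%:Z) -> exists t, age c t x = Some 0%N.
Proof.
case=> -[|n]; first by rewrite walk0 => -[<-]; exists 0%N.
move=> hit; suff [m] : exists m, age c n.+1 x = Some m by exact: age_awake.
rewrite /=; case: (age c n x) => [m|]; first by exists m.+1.
have wk : exists y m, age c n y = Some m /\ walk c y m.+1 = x%:Z.
  by exists 0%N, n; rewrite age_origin.
by exists 0%N; rewrite asboolT.
Qed.

Lemma visited_walks : (forall x : nat, exists n, walk c 0 n = x%:Z) ->
  visited c = [set z | exists x n, walk c x n = z].
Proof.
move=> hit; apply/seteqP; split => z /=.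
  by move=> [t [x [n [_ <-]]]]; exists x, n.
move=> [x [n <-]]; have [t tx] := all_awake (hit x).
by exists (n + t)%N, x, n; rewrite (age_after n tx) addn0.
Qed.

Lemma visited0 : visited c 0.
Proof. by exists 0%N, 0%N, 0%N; rewrite walk0. Qed.

End Dynamics.

Section NegMin.
Variables (R : realType) (c : nat -> nat -> bool).

Lemma neg_min_le (k : nat) :
  (neg_min c <= k%:R%:E :> \bar R)%E <-> (forall z, visited c z -> - k%:Z <= z).
Proof.
rewrite /neg_min leeNl; split => [le z cz|le].
  have : ((- k%:R)%:E <= (z%:~R)%:E :> \bar R)%E.
    by apply: (le_trans le); apply: ereal_inf_lbound; exists z.
  by rewrite lee_fin -(ler_int R) rmorphN.
apply: le_ereal_inf_tmp => _ [z cz <-].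
by rewrite -EFinN lee_fin -[k%:R]/(k%:~R) -rmorphN ler_int le.
Qed.

Lemma neg_min_ge0 : (0 <= neg_min c :> \bar R)%E.
Proof.
rewrite /neg_min leeNr oppe0; apply: ereal_inf_lbound.
by exists 0 => //; exact: visited0.
Qed.

(** Sites are integers: if the bound [k] fails, some visited site is at most -(k+1). *)
Lemma neg_minS (k : nat) : neg_min c = k.+1%:R%:E :> \bar R <->
  (neg_min c <= k.+1%:R%:E :> \bar R)%E /\ ~ (neg_min c <= k%:R%:E :> \bar R)%E.
Proof.
split=> [->|[leS /negP gt]].
  by rewrite lexx lee_fin ler_nat ltnn.
apply/eqP; rewrite eq_le leS /=.
have [z cz zk] : exists2 z, visited c z & z < - k%:Z.
  apply: contrapT => H; apply: (negP gt); apply/neg_min_le => z cz.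
  by rewrite leNgt; apply/negP => zk; apply: H; exists z.
rewrite /neg_min leeNr; apply: (le_trans (ereal_inf_lbound _)); first by exists z.
by rewrite -EFinN lee_fin -[k.+1%:R]/(k.+1%:~R) -rmorphN ler_int; lia.
Qed.

Lemma neg_min_cases :
  (exists k : nat, neg_min c = k%:R%:E :> \bar R) \/ neg_min c = +oo%E :> \bar R.
Proof.
have [[k le]|none] := pselect (exists k : nat, (neg_min c <= k%:R%:E :> \bar R)%E).
  left; elim: k le => [|k IH] le.
    by exists 0%N; apply/eqP; rewrite eq_le le neg_min_ge0.
  have [/IH //|gt] := pselect ((neg_min c <= k%:R%:E :> \bar R)%E).
  by exists k.+1; apply/neg_minS.
right; have := neg_min_ge0; case: (neg_min c) none => // r none _.
case: none; exists (Num.bound `|r|); rewrite lee_fin ltW //.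
by rewrite (le_lt_trans (ler_norm _)) // archi_boundP.
Qed.

End NegMin.

(** * Measurability of X *)

Section Measurability.
Variables (R : realType) (d : measure_display) (T : measurableType d).
Variables (P : probability T R) (xi : nat * nat -> {RV P >-> bool}).
Let dirs (w : T) x i := xi (x, i) w.

Lemma measurable_exists (Q : nat -> T -> Prop) :
  (forall n, measurable [set w | Q n w]) -> measurable [set w | exists n, Q n w].
Proof.
move=> mQ; rewrite (_ : [set _ | _] = \bigcup_n [set w | Q n w]).
  exact: bigcup_measurable.
by apply/seteqP; split => w /= [n]; [exists n|move=> _; exists n].
Qed.

Lemma measurable_walk x n z : measurable [set w | walk (dirs w) x n = z].
Proof.
elim: n z => [|n IH] z.
  have [e|e] := eqVneq x%:Z z.
    rewrite (_ : [set _ | _] = setT) //; apply/seteqP; split => w //= _.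
    by rewrite walk0.
  rewrite (_ : [set _ | _] = set0) //; apply/seteqP; split => w //=.
  by rewrite walk0 => /eqP; rewrite (negPf e).
have -> : [set w | walk (dirs w) x n.+1 = z] =
    (xi (x, n) @^-1` [set true] `&` [set w | walk (dirs w) x n = z - 1]) `|`
    (xi (x, n) @^-1` [set false] `&` [set w | walk (dirs w) x n = z + 1]).
  apply/seteqP; split => w /=; rewrite walkS /step_of /dirs; case: (xi _ w).
  - by move=> <-; left; rewrite addrK.
  - by move=> <-; right; rewrite subrK.
  - by move=> [[_ ->]|[//]]; rewrite subrK.
  - by move=> [[//]|[_ ->]]; rewrite addrK.
by apply: measurableU; apply: measurableI => //;
  rewrite -[X in measurable X]setTI; exact: measurable_funP.
Qed.

Lemma measurable_age t x o : measurable [set w | age (dirs w) t x = o].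
Proof.
elim: t x o => [|t IH] x o.
  have [e|e] := pselect ((if x == 0%N then Some 0%N else None) = o).
    by rewrite (_ : [set _ | _] = setT) //; apply/seteqP; split.
  by rewrite (_ : [set _ | _] = set0) //; apply/seteqP; split.
pose woken : set T := [set w | exists y n,
  age (dirs w) t y = Some n /\ walk (dirs w) y n.+1 = x%:Z].
have mwoken : measurable woken.
  apply: measurable_exists => y; apply: measurable_exists => n.
  by apply: measurableI; [exact: IH|exact: measurable_walk].
case: o => [[|n]|].
- rewrite (_ : [set _ | _] = [set w | age (dirs w) t x = None] `&` woken).
    by apply: measurableI => //; exact: IH.
  apply/seteqP; split => w /=.
    by case: (age _ t x) => [//|]; case: asboolP.
  by case=> -> wk; rewrite asboolT.
- rewrite (_ : [set _ | _] = [set w | age (dirs w) t x = Some n]); first exact: IH.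
  apply/seteqP; split => w /=; last by move=> ->.
  by case: (age _ t x) => [n'|]; [move=> [->]|case: asboolP].
- rewrite (_ : [set _ | _] = [set w | age (dirs w) t x = None] `&` ~` woken).
    by apply: measurableI; [exact: IH|exact: measurableC].
  apply/seteqP; split => w /=.
    by case: (age _ t x) => [//|]; case: asboolP.
  by case=> -> wk; rewrite asboolF.
Qed.

Lemma measurable_visited z : measurable [set w | visited (dirs w) z].
Proof.
do 3!apply: measurable_exists => ?.
by apply: measurableI; [exact: measurable_age|exact: measurable_walk].
Qed.

Lemma measurable_frog_X_le (k : nat) :
  measurable [set w | (frog_X xi w <= k%:R%:E)%E].
Proof.
rewrite (_ : [set _ | _] =
    ~` [set w | exists j : nat, visited (dirs w) (- (k.+1 + j)%:Z)]).
  apply: measurableC; apply: measurable_exists => j; exact: measurable_visited.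
apply/seteqP; split => w /=.
  by move=> /neg_min_le le [j /le]; lia.
move=> none; apply/neg_min_le => z vz; rewrite leNgt; apply/negP => zk.
apply: none; exists (absz (z + k.+1%:Z)).
by rewrite (_ : - _ = z) //; lia.
Qed.

Lemma measurable_frog_X_eq (k : nat) :
  measurable [set w | frog_X xi w = k%:R%:E].
Proof.
case: k => [|k].
  rewrite (_ : [set _ | _] = [set w | (frog_X xi w <= 0%:R%:E)%E]).
    exact: measurable_frog_X_le.
  apply/seteqP; split => w /=; first by move=> ->.
  by move=> le; apply/eqP; rewrite eq_le le; exact: neg_min_ge0.
rewrite (_ : [set _ | _] = [set w | (frog_X xi w <= k.+1%:R%:E)%E] `\`
    [set w | (frog_X xi w <= k%:R%:E)%E]).
  by apply: measurableD; exact: measurable_frog_X_le.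
by apply/seteqP; split => w /= /neg_minS.
Qed.

(** The only values of X are the naturals and +oo, so a preimage is a countable union of level sets,
    together with the complement of all of them when [g +oo] lies in [B]. *)
Lemma measurable_fun_frog_X D (g : \bar R -> \bar R) : measurable D ->
  measurable_fun D ((fun w => g (frog_X xi w)) : T -> \bar R).
Proof.
move=> mD _ B _; apply: measurableI => //.
pose I := \bigcup_(k in [set k : nat | B (g k%:R%:E)]) [set w | frog_X xi w = k%:R%:E].
have mI : measurable I by apply: bigcup_measurable => k _; exact: measurable_frog_X_eq.
pose J := [set w | B (g +oo%E)] `\` \bigcup_k [set w | frog_X xi w = k%:R%:E].
have mJ : measurable J.
  apply: measurableD; last by apply: bigcup_measurable => k _; exact: measurable_frog_X_eq.
  have [e|e] := pselect (B (g +oo%E)).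
    by rewrite (_ : [set _ | _] = setT) //; apply/seteqP; split.
  by rewrite (_ : [set _ | _] = set0) //; apply/seteqP; split.
rewrite (_ : _ @^-1` _ = I `|` J); first exact: measurableU.
apply/seteqP; split => w /=.
  have [[k e]|e] := neg_min_cases R (dirs w); rewrite {1}/frog_X e => Bg.
    by left; exists k.
  by right; split=> // -[k _]; rewrite /= /frog_X e.
case=> [[k /= Bg ->] //|[Bg none]].
have [[k e]|e] := neg_min_cases R (dirs w); last by rewrite /frog_X e.
by case: none; exists k.
Qed.

End Measurability.

(** * Tails of the Euler product *)

Section Euler.
Variables (R : realType) (rho : R).
Hypotheses (rho0 : 0 < rho) (rho1 : rho < 1).

(* [euler_tail k] is the product of the 1 - rho^j over j > k. *)
Definition euler_partial k M : R := \prod_(x < M) (1 - rho ^+ (k.+1 + x)).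
Definition euler_tail k : R := limn (euler_partial k).

Lemma euler_factor_itv n : 0 <= 1 - rho ^+ n <= 1.
Proof.
rewrite subr_ge0 exprn_ile1 ?(ltW rho0) ?(ltW rho1) //=.
by rewrite lerBlDr lerDl exprn_ge0 // ltW.
Qed.

Lemma euler_partial_itv k M : 0 <= euler_partial k M <= 1.
Proof.
rewrite prodr_ge0 => [|x _]; last by case/andP: (euler_factor_itv (k.+1 + x)).
by apply: prodr_ile1 => x _; exact: euler_factor_itv.
Qed.

Lemma euler_tail_cvg k : euler_partial k @ \oo --> euler_tail k.
Proof.
apply: nonincreasing_is_cvgn.
  apply/nonincreasing_seqP => M; rewrite /euler_partial big_ord_recr /=.
  rewrite ler_piMr //; first by case/andP: (euler_partial_itv k M).
  by case/andP: (euler_factor_itv (k.+1 + M)).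
by exists 0 => _ [M _ <-]; case/andP: (euler_partial_itv k M).
Qed.

Lemma euler_tail_itv k : 0 <= euler_tail k <= 1.
Proof.
apply/andP; split.
  by apply: (limr_ge (cvgP _ (@euler_tail_cvg k))); apply: nearW => M;
    case/andP: (euler_partial_itv k M).
by apply: (limr_le (cvgP _ (@euler_tail_cvg k))); apply: nearW => M;
  case/andP: (euler_partial_itv k M).
Qed.

Lemma euler_tailS k : euler_tail k.+1 * (1 - rho ^+ k.+1) = euler_tail k.
Proof.
have lhs : euler_partial k M.+1 @[M --> \oo] --> euler_tail k.+1 * (1 - rho ^+ k.+1).
  rewrite (_ : (fun _ => _) = fun M => euler_partial k.+1 M * (1 - rho ^+ k.+1)).
    by apply: cvgMr_tmp; exact: euler_tail_cvg.
  apply/funext => M; rewrite /euler_partial big_ord_recl addn0 mulrC.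
  by congr (_ * _); apply: eq_bigr => x _; rewrite lift0 addnS.
have rhs : euler_partial k M.+1 @[M --> \oo] --> euler_tail k.
  by rewrite (cvg_shiftS (euler_partial k)); exact: euler_tail_cvg.
exact: (cvg_unique (@norm_hausdorff R R) lhs rhs).
Qed.

(** A product of factors 1 - r is at least 1 minus the sum of the r, here a geometric sum. The bound
    makes the tails tend to 1, which is why X is almost surely finite. *)
Lemma euler_tail_ge k : 1 - rho ^+ k.+1 / (1 - rho) <= euler_tail k.
Proof.
have union_bound M : 1 - \sum_(x < M) rho ^+ (k.+1 + x) <= euler_partial k M.
  elim: M => [|M IH]; rewrite /euler_partial; first by rewrite !big_ord0 subr0.
  rewrite !big_ord_recr /= -/(euler_partial k M).
  have := euler_partial_itv k M; have := euler_factor_itv (k.+1 + M).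
  move: (rho ^+ _) (euler_partial k M) (\sum_(x < M) _) IH => r e s.
  by move=> IH /andP[r1 r0] /andP[e0 e1]; nra.
apply: (limr_ge (cvgP _ (@euler_tail_cvg k))); apply: nearW => M.
apply: le_trans (union_bound M); rewrite lerB // ler_pdivlMr ?subr_gt0 //.
under eq_bigr do rewrite exprD.
rewrite -big_distrr /= -mulrA ler_piMr ?exprn_ge0 ?(ltW rho0) // mulrC.
have -> : (1 - rho) * \sum_(i < M) rho ^+ i = 1 - rho ^+ M.
  by rewrite -opprB mulNr -subrX1 opprB.
by case/andP: (euler_factor_itv M).
Qed.

Lemma euler_tail_cvg1 : euler_tail @ \oo --> (1 : R).
Proof.
have c : 1 - rho ^+ k.+1 / (1 - rho) @[k --> \oo] --> (1 - 0 / (1 - rho) : R).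
  apply: cvgB; first exact: cvg_cst.
  apply: cvgMr_tmp; rewrite (cvg_shiftS (fun k => rho ^+ k)).
  by apply: cvg_expr; rewrite ger0_norm ?ltW.
rewrite mul0r subr0 in c.
apply: (@squeeze_cvgr _ _ _ _ _ (cst 1) _ _ _ c); last exact: cvg_cst.
by apply: nearW => k; rewrite euler_tail_ge /=; case/andP: (euler_tail_itv k).
Qed.

End Euler.

(** * Law of X and its moments *)

Section Law.
Variables (R : realType) (rho : R).
Hypotheses (rho0 : 0 < rho) (rho1 : rho < 1).
Variables (d : measure_display) (T : measurableType d) (P : probability T R).
Variable xi : nat * nat -> {RV P >-> bool}.
Hypothesis hxi : frog_steps (1 / (1 + rho)) xi.
Let dirs (w : T) x i := xi (x, i) w.
Let p : R := 1 / (1 + rho).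

Lemma prob_bigcap_lim (F : nat -> set T) (u : nat -> R) l :
  (forall n, measurable (F n)) -> (forall n, F n.+1 `<=` F n) ->
  (forall n, P (F n) = (u n)%:E) -> u @ \oo --> l -> P (\bigcap_n F n) = l%:E.
Proof.
move=> mF decr PF ul.
have c : P \o F @ \oo --> P (\bigcap_n F n).
  apply: nonincreasing_cvg_mu => //.
  - by rewrite (le_lt_trans (probability_le1 _ _)) ?ltry.
  - exact: bigcap_measurable.
  - by apply/nonincreasing_seqP => n; apply/subsetPset; exact: decr.
have c' : P \o F @ \oo --> l%:E.
  rewrite (_ : _ \o _ = fun n => (u n)%:E); last by apply/funext => n /=.
  by apply: cvg_EFin => //; exact: nearW.
exact: (cvg_unique (@ereal_hausdorff R) c c').
Qed.

(** With direction [false] the height is the distance from the origin's walk up to site [h], which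
    grows on steps -1. *)
Let never_hit h : set T := \bigcap_N surv_event xi false 0 0 N h.

Let measurable_never_hit h : measurable (never_hit h).
Proof. by apply: bigcap_measurable => // N _; exact: measurable_surv. Qed.

Lemma prob_never_hit h : P (never_hit h) = 0%E.
Proof.
have p0 : 0 < 1 - p by rewrite subr_gt0 drift_lt1.
have p1 : 1 - p < 1 by rewrite ltrBlDr ltrDl drift_gt0.
apply: (prob_bigcap_lim (u := fun N => surv_prob (1 - p) N h)) => [N|N w|N|].
- exact: measurable_surv.
- exact: survSW.
- exact: prob_surv_left.
- by rewrite -(surv_lim_left rho0 rho1 h); exact: surv_prob_cvg.
Qed.

(** The null event that must be discarded: outside it the origin's frog reaches every site [h], so
    every frog wakes up. *)
Let lazy : set T := \bigcup_h never_hit h.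

Let measurable_lazy : measurable lazy.
Proof. exact: bigcup_measurable. Qed.

Let prob_lazy : P lazy = 0%E.
Proof.
apply/eqP; rewrite eq_le measure_ge0 andbT.
apply: (le_trans (measure_sigma_subadditive _ _ _ (@subset_refl _ _))) => //.
by rewrite eseries0 // => h _ _; exact: prob_never_hit.
Qed.

Lemma visited_ae w : ~ lazy w ->
  visited (dirs w) = [set z | exists x n, walk (dirs w) x n = z].
Proof.
move=> nl; apply: visited_walks => h.
have [N /negP] : exists N, ~ surv false (dirs w) 0 0 N h.
  apply: contrapT => H; apply: nl; exists h => // N _.
  by apply: contrapT => nN; apply: H; exists N.
move=> /surv_hit [j]; rewrite add0n => hj; exists j.
(* Comparing a direction with [false] reverses the sign of the step, so height 0 at time [j] means
   position [h]. *)
apply/eqP; rewrite -subr_eq0 -oppr_eq0 opprB -hj /walk add0r big_mkord -sumrN.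
apply/eqP; congr (_ + _); apply: eq_bigr => i _.
by rewrite /step_of; case: (dirs _ _ _).
Qed.

Let stays k M : set T := \bigcap_N surv_upto xi k N M.

Let measurable_surv_upto k N M : measurable (surv_upto xi k N M).
Proof. by case: (indep_surv_upto hxi k N M). Qed.

Let measurable_stays k M : measurable (stays k M).
Proof. by apply: bigcap_measurable. Qed.

Lemma prob_stays k M : P (stays k M) = (euler_partial rho k M)%:E.
Proof.
have p0 := drift_gt0 rho0; have p1 := drift_lt1 rho0.
apply: (prob_bigcap_lim (u := fun N => \prod_(x < M) surv_prob p N (k.+1 + x))).
- by [].
- by move=> N w s x xM; apply: survSW; exact: s.
- by move=> N; exact: indep_from_prob (indep_surv_upto hxi k N M).
rewrite /euler_partial; elim: (M) => [|M' IH].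
  by under eq_fun do rewrite big_ord0; rewrite big_ord0; exact: cvg_cst.
under eq_fun do rewrite big_ord_recr /=; rewrite big_ord_recr /=.
by apply: cvgM => //; rewrite -(surv_lim_right rho0 rho1); exact: surv_prob_cvg.
Qed.

Lemma prob_all_stay k : P (\bigcap_M stays k M) = (euler_tail rho k)%:E.
Proof.
apply: (prob_bigcap_lim (u := euler_partial rho k)) => //.
- by move=> M w s N _ x xM; apply: (s N) => //; exact: ltnW.
- by move=> M; exact: prob_stays.
- exact: euler_tail_cvg.
Qed.

Lemma frog_X_le_ae k w : ~ lazy w ->
  (frog_X xi w <= k%:R%:E)%E <-> (\bigcap_M stays k M) w.
Proof.
move=> nl; rewrite neg_min_le visited_ae //; split => [ge M _ N _ x xM|s z [x [n <-]]].
  apply/survE => j jN; rewrite add0n big_mkord.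
  have := ge (walk (dirs w) x j) (ex_intro _ x (ex_intro _ j erefl)).
  rewrite /walk; under [X in _ < _ + X]eq_bigr do rewrite eqb_id.
  by move: (\sum_(_ < _) _) => S; rewrite /dirs; lia.
have /survE /(_ n (leqnn n)) := s x.+1 I n I x (ltnSn x).
rewrite add0n big_mkord; under [X in _ < _ + X]eq_bigr do rewrite eqb_id.
by rewrite /walk; move: (\sum_(_ < _) _) => S; lia.
Qed.

Lemma prob_frog_X_le k : P [set w | (frog_X xi w <= k%:R%:E)%E] = (euler_tail rho k)%:E.
Proof.
have mbig : measurable (\bigcap_M stays k M) by apply: bigcap_measurable.
have mle := measurable_frog_X_le xi k.
(* The two events agree only outside [lazy], so they are compared after removing it. *)
have off_lazy (A : set T) : measurable A -> P A = P (A `\` lazy).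
  move=> mA; rewrite measureD //; last by rewrite (le_lt_trans (probability_le1 _ _)) ?ltry.
  rewrite [X in (_ - X)%E](_ : _ = 0%E) ?sube0 //.
  by apply: (subset_measure0 _ _ _ prob_lazy) => //; exact: measurableI.
rewrite -prob_all_stay off_lazy // [RHS]off_lazy //; congr (P _).
by apply/seteqP; split => w /= [A nl]; split=> //; apply/(frog_X_le_ae k nl).
Qed.

Definition frog_pmf k : R := rho ^+ k * euler_tail rho k.

Lemma prob_frog_X k : P [set w | frog_X xi w = k%:R%:E] = (frog_pmf k)%:E.
Proof.
rewrite /frog_pmf; case: k => [|k].
  rewrite expr0 mul1r -prob_frog_X_le; congr (P _).
  apply/seteqP; split => w /=; first by move=> ->.
  by move=> le; apply/eqP; rewrite eq_le le; exact: neg_min_ge0.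
have sub w : (frog_X xi w <= k%:R%:E)%E -> (frog_X xi w <= k.+1%:R%:E)%E.
  by move/le_trans; apply; rewrite lee_fin ler_nat.
rewrite (_ : [set _ | _] = [set w | (frog_X xi w <= k.+1%:R%:E)%E] `\`
    [set w | (frog_X xi w <= k%:R%:E)%E]); last first.
  by apply/seteqP; split => w /= /neg_minS.
rewrite measureD; try exact: measurable_frog_X_le; last first.
  by rewrite (le_lt_trans (probability_le1 _ _)) ?ltry //; exact: measurable_frog_X_le.
rewrite setIidr //.
apply: etrans (congr2 (fun a b => a - b)%E (prob_frog_X_le k.+1) (prob_frog_X_le k)) _.
by rewrite -EFinB -(euler_tailS rho0 rho1 k); congr EFin; ring.
Qed.

Lemma frog_pmf_ge0 k : 0 <= frog_pmf k.
Proof.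
by rewrite mulr_ge0 ?exprn_ge0 ?(ltW rho0) //; case/andP: (euler_tail_itv rho0 rho1 k).
Qed.

Lemma frog_pmfS k : frog_pmf k.+1 * (1 - rho ^+ k.+1) = rho * frog_pmf k.
Proof. by rewrite /frog_pmf -mulrA euler_tailS // exprS mulrA. Qed.

(** The partial sums telescope to [euler_tail rho n], which tends to 1. *)
Lemma frog_pmf_sum : (\sum_(k <oo) (frog_pmf k)%:E = 1)%E.
Proof.
have partial n : \sum_(0 <= k < n.+1) frog_pmf k = euler_tail rho n.
  elim: n => [|n IH]; first by rewrite big_nat1 /frog_pmf expr0 mul1r.
  by rewrite big_nat_recr //= IH -(euler_tailS rho0 rho1 n) /frog_pmf; ring.
apply/cvg_lim => //; rewrite -cvg_shiftS.
rewrite (_ : (fun _ => _) = fun n => (euler_tail rho n)%:E); last first.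
  by apply/funext => n; rewrite sumEFin partial.
by apply: cvg_EFin; [exact: nearW|exact: euler_tail_cvg1].
Qed.

(** By [frog_pmf_sum] the level sets of finite values carry mass 1, so the value +oo is negligible
    and the integral splits over sets where the integrand is constant. *)
Lemma integral_frog_X_expr m : (\int[P]_w (frog_X xi w ^+ m) = moment frog_pmf m)%E.
Proof.
pose E k := [set w | frog_X xi w = k%:R%:E].
have mE k : measurable (E k) by exact: measurable_frog_X_eq.
have tE : trivIset setT E.
  apply/trivIsetP => i j _ _ ij; apply/seteqP; split => w //= [].
  by rewrite /E /= => -> [] /eqP; rewrite eqr_nat (negPf ij).
have mbig : measurable (\bigcup_k E k) by exact: bigcup_measurable.
have PE : P (\bigcup_k E k) = 1%E.
  rewrite measure_semi_bigcup //; apply: etrans frog_pmf_sum.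
  by apply: eq_eseriesr => k _; exact: prob_frog_X.
have ge0 w : (0 <= frog_X xi w ^+ m)%E by apply: expe_ge0; exact: neg_min_ge0.
have mX D : measurable D ->
    measurable_fun D ((fun w => frog_X xi w ^+ m)%E : T -> \bar R).
  exact: (measurable_fun_frog_X xi (fun x => x ^+ m)%E).
have P0 : P (~` \bigcup_k E k) = 0%E by rewrite probability_setC // PE subee.
apply: etrans (ge0_negligible_integral (measurableC mbig) measurableT
  (mX _ measurableT) (fun w _ => ge0 w) P0) _.
rewrite setDE setCK setTI ge0_integral_bigcup //; last exact: mX.
apply: eq_eseriesr => k _.
rewrite (eq_integral (cst (k%:R ^+ m)%:E)); last first.
  by move=> w; rewrite inE /= => ->; rewrite EFin_expe.
by rewrite integral_cst // EFinM; congr (_ * _)%E; exact: prob_frog_X.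
Qed.

End Law.

Theorem theorem3 (R : realType) (rho : R) (hrho0 : 0 < rho) (hrho1 : rho < 1)
    (d : measure_display) (T : measurableType d) (P : probability T R)
    (xi : nat * nat -> {RV P >-> bool})
    (hxi : frog_steps (1 / (1 + rho)) xi)
    (m : nat) (hm : (1 <= m)%N) :
  (\int[P]_w (frog_X xi w ^+ m) = (complete_bell m (kappa rho))%:E)%E.
Proof.
rewrite (integral_frog_X_expr hrho0 hrho1 hxi) (complete_bellE _ hm (leqnn m)).
apply: moment_bell => //; first exact: frog_pmf_ge0.
- exact: frog_pmfS.
- exact: frog_pmf_sum.
Qed.
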